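(* Let $\{A_n\}_{n\ge 0}$ be the Aleshin graphs and $\{B_n\}_{n\ge 0}$ the Bellaterra graphs. Then their diameters grow at most quadratically in $n$, i.e. $$\operatorname{diam}(A_n)=O(n^2)\quad\text{and}\quad \operatorname{diam}(B_n)=O(n^2)\qquad\text{as } n\to\infty.$$
   Context: Graphs are directed, and self-loops and repeated edges are allowed. The distance $d(v,w)$ between two vertices of a graph is the length of a shortest undirected path between them (edges may be traversed in either direction), and is $\infty$ if there is no such path. The diameter of a graph is the maximum of $d(v,w)$ over all pairs of vertices. The Aleshin graphs $A_0,A_1,A_2,\dots$ are directed graphs with edges labeled by $a,b,c$. $A_0$ is a single vertex with three self-loops labeled $a$, $b$, $c$. Given $A_n$, the graph $A_{n+1}$ has two vertices $v_0,v_1$ for each vertex $v$ of $A_n$, and each edge of $A_n$ gives two edges of $A_{n+1}$ by the following rules (and these are all the edges of $A_{n+1}$): - an edge $v\to w$ labeled $a$ gives an edge $v_0\to w_0$ labeled $c$ and an edge $v_1\to w_1$ labeled $c$; - an edge $v\to w$ labeled $b$ gives an edge $v_0\to w_1$ labeled $a$ and an edge $v_1\to w_0$ labeled $b$; - an edge $v\to w$ labeled $c$ gives an edge $v_0\to w_1$ labeled $b$ and an edge $v_1\to w_0$ labeled $a$. The Bellaterra graphs $B_0,B_1,B_2,\dots$ are defined in the same way, starting from $B_0=A_0$, but with the rules: - an edge $v\to w$ labeled $a$ gives an edge $v_0\to w_1$ labeled $c$ and an edge $v_1\to w_0$ labeled $c$; - an edge $v\to w$ labeled $b$ gives an edge $v_0\to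 w_0$ labeled $a$ and an edge $v_1\to w_1$ labeled $b$; - an edge $v\to w$ labeled $c$ gives an edge $v_0\to w_0$ labeled $b$ and an edge $v_1\to w_1$ labeled $a$. *)

(* Defs.v *)
From HB Require Import structures.
From mathcomp Require Import all_boot all_order all_algebra.
From mathcomp Require Import all_classical all_reals all_analysis.

Set Implicit Arguments.
Unset Strict Implicit.
Unset Printing Implicit Defensive.

Import Order.TTheory GRing.Theory Num.Theory.
Import numFieldNormedType.Exports.
Local Open Scope classical_set_scope.
Local Open Scope ring_scope.

Inductive label := La | Lb | Lc.

Definition ord_of_label (l : label) : 'I_3 :=
  match l with La => inord 0 | Lb => inord 1 | Lc => inord 2 end.
Definition label_of_ord (i : 'I_3) : label :=
  match val i with 0%N => La | 1%N => Lb | _ => Lc end.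
Lemma ord_of_labelK : cancel ord_of_label label_of_ord.
Proof. by case; rewrite /label_of_ord /= inordK. Qed.

HB.instance Definition _ := Finite.copy label (can_type ord_of_labelK).

Record lgraph := LGraph {
  vertex : finType;
  edge : finType;
  src : edge -> vertex;
  tgt : edge -> vertex;
  lab : edge -> label
}.

Definition adj (G : lgraph) : rel (vertex G) := fun x y =>
  [exists e : edge G, (src e == x) && (tgt e == y)
                   || (src e == y) && (tgt e == x)].

(* The walk v :: p has size p edges. *)
Definition path_lengths (G : lgraph) (v w : vertex G) : set nat :=
  [set k | exists p : seq (vertex G),
             [/\ path (@adj G) v p, last v p = w & size p = k]].

(* The infimum of the empty set is +oo; any other infimum here is attained,
   being taken over natural numbers. *)
Definition dist (R : realType) (G : lgraph) (v w : vertex G) : \bar R :=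
  ereal_inf [set (k%:R)%:E | k in path_lengths v w].

(* The set of vertices is finite, so for a nonempty graph this is a maximum. *)
Definition diam (R : realType) (G : lgraph) : \bar R :=
  ereal_sup [set dist R vw.1 vw.2 | vw in [set: vertex G * vertex G]].

Definition rose : lgraph :=
  @LGraph unit label (fun=> tt) (fun=> tt) id.

(* The vertex v_0 is (v, false) and v_1 is (v, true).  The edge (e, i) is the
   one obtained from e that starts at (src e)_i; if rule (lab e) i = (j, l),
   then it ends at (tgt e)_j and is labeled l. *)
Definition lift_graph (rule : label -> bool -> bool * label) (G : lgraph) :
    lgraph :=
  @LGraph (vertex G * bool)%type (edge G * bool)%type
    (fun ei => (src ei.1, ei.2))
    (fun ei => (tgt ei.1, (rule (lab ei.1) ei.2).1))
    (fun ei => (rule (lab ei.1) ei.2).2).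

Definition aleshin_rule (l : label) (i : bool) : bool * label :=
  match l, i with
  | La, false => (false, Lc)
  | La, true  => (true,  Lc)
  | Lb, false => (true,  La)
  | Lb, true  => (false, Lb)
  | Lc, false => (true,  Lb)
  | Lc, true  => (false, La)
  end.

Definition bellaterra_rule (l : label) (i : bool) : bool * label :=
  match l, i with
  | La, false => (true,  Lc)
  | La, true  => (false, Lc)
  | Lb, false => (false, La)
  | Lb, true  => (true,  Lb)
  | Lc, false => (false, Lb)
  | Lc, true  => (true,  La)
  end.

Definition aleshin (n : nat) : lgraph := iter n (lift_graph aleshin_rule) rose.

Definition bellaterra (n : nat) : lgraph :=
  iter n (lift_graph bellaterra_rule) rose.

(* The relation =O_\oo of MathComp-Analysis takes values in a normed module,
   which excludes +oo; this is the same relation for extended real sequences,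
   see bigO_inftyE. *)
Definition bigO_infty (R : realType) (u : (\bar R)^nat) (g : R^nat) : Prop :=
  exists C : R, \forall n \near \oo, (`|u n| <= (C * `|g n|)%:E)%E.

Lemma bigO_inftyE (R : realType) (u g : R^nat) :
  bigO_infty (fun n => (u n)%:E) g <-> u =O_\oo g.
Proof.
split=> [[C uC]|/eqO_exP [C _ uC]].
  apply/eqO_exP; exists (Num.max C 1); first by rewrite lt_max ltr01 orbT.
  apply: filterS uC => n; rewrite lee_fin => /le_trans; apply.
  by rewrite ler_wpM2r // le_max lexx.
by exists C; apply: filterS uC => n; rewrite lee_fin.
Qed.

(* Main.v *)
Require Import Defs.
From HB Require Import structures.
From mathcomp Require Import all_boot all_order all_algebra.
From mathcomp Require Import all_classical all_reals all_analysis.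
From mathcomp Require Import zify.

Set Implicit Arguments.
Unset Strict Implicit.
Unset Printing Implicit Defensive.

Import Order.TTheory GRing.Theory Num.Theory.
Import numFieldNormedType.Exports.
Local Open Scope classical_set_scope.
Local Open Scope ring_scope.

(** Walk labels in the Bellaterra graphs evolve by an automaton: a walk
reading a word W from x in B_n lifts, once the new bit i at x is chosen, to a
walk from (x, i) in B_(n+1) that reads another word, lift_word i W.  Every word
is read in B_0, so after n lifts with i = 1 it is read from the vertex 1^n of
B_n, and the bits of the vertex reached are
s_j = lift_end 1 (T^j W), j < n, where T = lift_word 1.

Two facts about T drive the proof.  First, T is an odometer (odometer): there
are words W of every length m that T brings back to W after 2^m steps, with
s_0 + ... + s_(2^m - 1) odd.  Such a sequence s has no period smaller than 2^m.
Second (exists_splitting_window), if n < m then two of the 2^m cyclic windows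
of length n of s agree while the bits that follow them differ: some windows
coincide by the pigeonhole principle, and if equal windows always had equal
successors then s would have a smaller period.  In the graphs, taking
m = n + 1, two words of length n + 1 lead from 1^n to the same vertex of B_n but
from 1^n 1 to two vertices that differ in the last bit only.  Hence the vertices
1^n 1 and 1^n 0 of B_(n+1) are at distance at most 2 (n + 1) (within_ends),
although the graph has exponentially many vertices.

The edge labeled b at 1^n is a loop, so the edge labeled a at 1^n 0 is a loop as
well, and an a-loop at v lifts to an edge joining the two vertices above v.  A
walk from x to the vertex carrying the a-loop therefore lifts to a walk from
(x, i) to either vertex above it at the cost of one more step, after which the
linear bound leads on to the next vertex with an a-loop.  Summing linear costs
gives the distance n^2 from any vertex to that one (within_a_end), and going
around its loop makes the length of a walk even when desired (even_reads).

The Aleshin rules are the Bellaterra rules followed by a flip of the new bit.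
So if f flips all bits, an edge joining x and z in B_n is an edge from x to f z
in A_n, and a walk of even length in B_n is, up to applying f to every other
vertex, a walk with the same ends in A_n. *)

(** * Windows of periodic binary sequences *)

Section Combinatorics.
Local Open Scope nat_scope.

Lemma xor_sum_double (f : nat -> bool) n :
  \big[addb/false]_(0 <= j < n + n) f j =
  \big[addb/false]_(0 <= j < n) (f j (+) f (j + n)).
Proof.
rewrite (@big_cat_nat _ _ _ n) ?leq_addr//= big_split/=; congr (_ (+) _).
by rewrite -{1}[n]add0n big_addn addnK.
Qed.

Lemma period_mul (s : nat -> bool) d : (forall t, s (t + d) = s t) ->
  forall k t, s (t + k * d) = s t.
Proof. by move=> s_d; elim=> [|k IHk] t; rewrite ?addn0// mulSn addnA IHk. Qed.

(** The odd part of [d] is invertible modulo a power of two, so some multiple of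
[d] is congruent to [2 ^ m] modulo [2 ^ m.+1]. *)
Lemma half_period (s : nat -> bool) m d :
  0 < d < 2 ^ m.+1 -> (forall t, s (t + 2 ^ m.+1) = s t) ->
  (forall t, s (t + d) = s t) -> forall t, s (t + 2 ^ m) = s t.
Proof.
move=> /andP[d_gt0 d_lt] s_per s_d t.
have [q q_cop dE] := pfactor_coprime (isT : prime 2) d_gt0.
have {q_cop} q_odd : odd q by rewrite -coprime2n.
have e_le : logn 2 d <= m.
  rewrite -ltnS -(@ltn_exp2l 2)//; apply: leq_ltn_trans d_lt.
  by rewrite dvdn_leq// pfactor_dvdnn.
have multE : 2 ^ (m - logn 2 d) * d = 2 ^ m + q./2 * 2 ^ m.+1.
  rewrite {2}dE mulnCA -expnD subnK// -{1}[q]odd_double_half q_odd mulnDl mul1n.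
  by rewrite expnS -muln2 mulnA.
by rewrite -(period_mul s_per q./2) -addnA -multE period_mul.
Qed.

(** If equal windows of length [n] always had equal next bits, then two equal
windows, provided by the pigeonhole principle, could be shifted forever; their
distance would be a period of [s], hence so would [2 ^ m.-1], and every bit
would occur twice in the sum. *)
Lemma exists_splitting_window (s : nat -> bool) m n : n < m ->
  (forall t, s (t + 2 ^ m) = s t) ->
  \big[addb/false]_(0 <= j < 2 ^ m) s j ->
  exists i k, (forall j, j < n -> s (i + j) = s (k + j)) /\
              s (i + n) = ~~ s (k + n).
Proof.
case: m => // m n_lt s_per s_odd.
pose win (i : 'I_(2 ^ m.+1)) := [tuple s (i + j) | j < n].
have /injectivePn [i [k ik wik]] : ~~ injectiveb win.
  apply/negP => /injectiveP /leq_card.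
  by rewrite card_ord card_tuple card_bool leq_exp2l// leqNgt n_lt.
apply: contrapT => nosplit.
have shift t j : j < n -> s (i + t + j) = s (k + t + j).
  elim: t j => [|t IHt] j j_lt.
    move: wik => /(congr1 (fun w => tnth w (Ordinal j_lt))).
    by rewrite !tnth_mktuple !addn0.
  rewrite !addnS !addSn -!addnS.
  have [j1|j1] := ltnP j.+1 n; first exact: IHt.
  have -> : j.+1 = n by apply/eqP; rewrite eqn_leq j_lt.
  apply: contrapT => /eqP neq; apply: nosplit; exists (i + t), (k + t).
  by split=> //; move: neq; case: (s _); case: (s _).
have {shift} shift t : s (i + n + t) = s (k + n + t).
  rewrite -!(addnAC _ t); apply: contrapT => /eqP neq; apply: nosplit.
  exists (i + t), (k + t); split; first exact: shift.
  by move: neq; case: (s _); case: (s _).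
have half t : s (t + 2 ^ m) = s t.
  clear wik nosplit.
  wlog ltik : i k ik shift / i < k.
    move=> wl; have := ik; rewrite neq_ltn => /orP[|] ltik; first exact: (wl i k).
    by apply: (wl k i); rewrite // eq_sym.
  apply: (@half_period s m (k - i)) => // [|u].
    by rewrite subn_gt0 ltik (leq_ltn_trans (leq_subr _ _)).
  (* [shift] only speaks of positions from [i + n] on: move there by a multiple
     of the known period. *)
  rewrite -(period_mul s_per (i + n)) -[RHS](period_mul s_per (i + n)).
  have le_in : i + n <= u + (i + n) * 2 ^ m.+1.
    by rewrite (leq_trans _ (leq_addl _ _))// leq_pmulr// expn_gt0.
  rewrite addnAC -(subnKC le_in) shift; congr s.
  rewrite -{2}(subnK (ltnW ltik)); lia.
move: s_odd; rewrite expnS mul2n -addnn xor_sum_double big1// => j _.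
by rewrite half addbb.
Qed.
End Combinatorics.

(** * The automaton acting on words of labels *)

Definition lift_letter (i : bool) (l : label) : label := (bellaterra_rule l i).2.
Definition next_bit (i : bool) (l : label) : bool := (bellaterra_rule l i).1.

Fixpoint lift_word (i : bool) (W : seq label) : seq label :=
  if W is l :: W' then lift_letter i l :: lift_word (next_bit i l) W' else [::].

Definition lift_end (i : bool) (W : seq label) : bool := foldl next_bit i W.

Section Words.
Local Open Scope nat_scope.

Lemma size_lift_word i W : size (lift_word i W) = size W.
Proof. by elim: W i => //= l W IHW i; rewrite IHW. Qed.

Lemma lift_word_rcons i W l :
  lift_word i (rcons W l) = rcons (lift_word i W) (lift_letter (lift_end i W) l).
Proof. by elim: W i => //= l' W IHW i; rewrite IHW. Qed.

Lemma lift_end_rcons i W l :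
  lift_end i (rcons W l) = next_bit (lift_end i W) l.
Proof. by rewrite /lift_end foldl_rcons. Qed.

Lemma lift_endN i W : lift_end (~~ i) W = ~~ lift_end i W.
Proof. by elim: W i => //= l W IHW i; rewrite -IHW; case: i; case: l. Qed.

Definition isA (l : label) : bool := if l is La then true else false.

(** The cyclic order a, b, c.  Once [y] is known, a letter other than [y] is
determined by whether it is the successor of [y], which turns the choice of such
a letter into a bit. *)
Definition succ_letter (y x : label) : bool :=
  match y, x with La, Lb | Lb, Lc | Lc, La => true | _, _ => false end.

Lemma next_bitE i l : next_bit i l = i (+) isA l.
Proof. by case: i l => -[]. Qed.

(** In state 0 the automaton permutes the letters cyclically and in state 1 it
transposes two of them.  It leaves a state only by reading an a, which both states
send to c; so [x] and the letter before it are transformed as if both were read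
in the state reached after [W], and the bit encoding [x] is flipped exactly when
this state is 1.  The default [Lb] for the empty word is the letter fixed
in the initial state 1, which keeps it in that state: the empty word behaves
as if preceded by a letter b. *)
Lemma lift_word_rcons_neq W x : x <> last Lb W ->
  exists x', [/\ lift_word true (rcons W x) = rcons (lift_word true W) x',
    x' <> last Lb (lift_word true W) &
    succ_letter (last Lb (lift_word true W)) x' =
    succ_letter (last Lb W) x (+) lift_end true W].
Proof.
move=> xW; exists (lift_letter (lift_end true W) x).
rewrite lift_word_rcons; move: xW; case/lastP: W => [|W y] /=.
  by case: x.
rewrite lift_word_rcons lift_end_rcons !last_rcons.
by move: (lift_end true W) => s; case: x y s => -[] [].
Qed.

Lemma iter_lift_word_rcons W x j : x <> last Lb W ->
  exists x', [/\ iter j (lift_word true) (rcons W x) =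
                 rcons (iter j (lift_word true) W) x',
    x' <> last Lb (iter j (lift_word true) W) &
    succ_letter (last Lb (iter j (lift_word true) W)) x' =
    succ_letter (last Lb W) x (+)
    \big[addb/false]_(0 <= t < j) lift_end true (iter t (lift_word true) W)].
Proof.
move=> xW; elim: j => [|j [x' [IH1 IH2 IH3]]].
  by exists x; split; rewrite ?big_geq ?addbF.
have [x'' [H1 H2 H3]] := lift_word_rcons_neq IH2.
exists x''; split; rewrite ?iterS ?IH1//.
by rewrite H3 IH3 big_nat_recr//= addbA.
Qed.

(** Induction on [m], appending to [W] a letter [x] other than its last one.  By
the first sum the encoding bit of [x] is flipped an odd number of times in
[2 ^ m] steps, so [W] returns with the other admissible letter and after
[2 ^ m.+1] steps everything returns.  Pairing the times [j] and [j + 2 ^ m], at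
which the last letters are the two letters other than the last letter [z] of
the [j]-th image of [W], shows that both sums of the longer word have the parity
of the number of times when [z] is not a: among these two letters there is
exactly one a if [z] is not a, and none if it is. *)
Lemma odometer m : exists W, [/\ size W = m,
  iter (2 ^ m) (lift_word true) W = W,
  \big[addb/false]_(0 <= j < 2 ^ m) lift_end true (iter j (lift_word true) W) &
  \big[addb/false]_(0 <= j < 2 ^ m)
    ~~ isA (last Lb (iter j (lift_word true) W))].
Proof.
elim: m => [|m [W [sizeW perW xorW lastW]]].
  by exists [::]; rewrite !big_nat1.
have [x xW] : exists x, x <> last Lb W.
  by case: (last Lb W); [exists Lb|exists Lc|exists La].
have [x' [HxW x'W succ']] := iter_lift_word_rcons (2 ^ m) xW.
rewrite perW xorW addbT in HxW x'W succ'.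
have other_letter y y' z : y <> z -> y' <> z ->
    succ_letter z y' = ~~ succ_letter z y -> isA y (+) isA y' = ~~ isA z.
  by case: y y' z => -[] [].
have pairE j : exists y y', [/\
    iter j (lift_word true) (rcons W x) = rcons (iter j (lift_word true) W) y,
    iter (j + 2 ^ m) (lift_word true) (rcons W x) =
      rcons (iter j (lift_word true) W) y' &
    isA y (+) isA y' = ~~ isA (last Lb (iter j (lift_word true) W))].
  have [y [H1 H2 H3]] := iter_lift_word_rcons j xW.
  have [y' [H1' H2' H3']] := iter_lift_word_rcons j x'W.
  exists y, y'; split=> //; first by rewrite iterD HxW.
  apply: other_letter => //; rewrite H3' H3 succ'.
  by case: succ_letter; case: (\big[_/_]_(_ <= _ < _) _).
have transfer (f : nat -> bool) :
    (forall j, f j = ~~ isA (last Lb (iter j (lift_word true) W))) ->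
    \big[addb/false]_(0 <= j < 2 ^ m) f j.
  by move=> fE; rewrite (eq_bigr _ (fun j _ => fE j)).
exists (rcons W x); rewrite size_rcons sizeW expnS mul2n -addnn !xor_sum_double.
split=> //.
- rewrite iterD HxW.
  have [x'' [-> x''W succ'']] := iter_lift_word_rcons (2 ^ m) x'W.
  rewrite perW xorW succ' in x''W succ''; congr rcons => //.
  move: (last Lb W) xW x''W succ'' => z.
  by case: x x'' z {HxW x'W succ' pairE} => -[] [].
- apply: transfer => j.
  have [y [y' [-> -> <-]]] := pairE j.
  rewrite !lift_end_rcons !next_bitE.
  by case: (lift_end _ _); case: (isA y); case: (isA y').
- apply: transfer => j.
  have [y [y' [-> -> <-]]] := pairE j.
  by rewrite !last_rcons; case: (isA y); case: (isA y').
Qed.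

End Words.

(** * Labeled walks and their lifts *)

Section LabeledWalks.
Local Open Scope nat_scope.

Definition joins (G : lgraph) (l : label) (x y : vertex G) : Prop :=
  exists2 e : edge G, lab e = l &
    (src e = x /\ tgt e = y) \/ (src e = y /\ tgt e = x).

Fixpoint reads (G : lgraph) (W : seq label) (x y : vertex G) : Prop :=
  if W is l :: W' then exists2 z, joins l x z & reads W' z y else x = y.

Lemma joinsC (G : lgraph) l (x y : vertex G) : joins l x y -> joins l y x.
Proof. by case=> e eE [] xy; exists e => //; [right|left]. Qed.

Lemma reads_cat (G : lgraph) W V (x y z : vertex G) :
  reads W x y -> reads V y z -> reads (W ++ V) x z.
Proof.
elim: W x => [x ->//|l W IHW x [u xu uy] yz].
by exists u => //; apply: IHW.
Qed.

Lemma reads_rev (G : lgraph) W (x y : vertex G) :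
  reads W x y -> reads (rev W) y x.
Proof.
elim: W x => [x ->//|l W IHW x [u xu uy]]; rewrite rev_cons -cats1.
by apply: (reads_cat (IHW _ uy)); exists x => //; apply: joinsC.
Qed.

Let lift := lift_graph bellaterra_rule.

(** Both traversals of an edge lift in the same way because each Bellaterra rule
exchanges the bits at the two ends of an edge: it commutes with reversal. *)
Lemma joins_lift (G : lgraph) l (x y : vertex G) i : joins l x y ->
  joins (G := lift G) (lift_letter i l) (x, i) (y, next_bit i l).
Proof.
case=> e <- [[<- <-]|[<- <-]]; first by exists (e, i) => //; left.
exists (e, next_bit i (lab e)) => /=.
  by case: i; case: (lab e).
right; split => //; congr (_, _).
by case: i; case: (lab e).
Qed.

Lemma reads_lift (G : lgraph) W (x y : vertex G) i : reads W x y ->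
  reads (G := lift G) (lift_word i W) (x, i) (y, lift_end i W).
Proof.
elim: W x i => [x i ->//|l W IHW x i [u xu uy]].
by exists (u, next_bit i l); [apply: joins_lift|apply: IHW].
Qed.

Definition within (G : lgraph) k (x y : vertex G) : Prop :=
  exists2 W, size W <= k & reads W x y.

Lemma withinC (G : lgraph) k (x y : vertex G) : within k x y -> within k y x.
Proof. by case=> W Wk xy; exists (rev W); rewrite ?size_rev//; apply: reads_rev. Qed.

Lemma within_trans (G : lgraph) k k' (x y z : vertex G) :
  within k x y -> within k' y z -> within (k + k') x z.
Proof.
case=> W Wk xy [V Vk yz]; exists (W ++ V); last exact: reads_cat yz.
by rewrite size_cat leq_add.
Qed.

Lemma within_lift (G : lgraph) k (x y : vertex G) i : within k x y ->
  exists j, within (G := lift G) k (x, i) (y, j).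
Proof.
case=> W Wk xy; exists (lift_end i W), (lift_word i W).
  by rewrite size_lift_word.
exact: reads_lift.
Qed.

Lemma joins_within (G : lgraph) l (x y : vertex G) : joins l x y -> within 1 x y.
Proof. by move=> xy; exists [:: l] => //; exists y. Qed.

(** * Distances in the Bellaterra graphs *)

(** The vertices 1^n and 1^(n-1) 0, ends of the graph in the sense that they carry
loops labeled b and a respectively. *)
Fixpoint b_end n : vertex (bellaterra n) :=
  if n is n'.+1 then (b_end n', true) else tt.

Definition a_end n : vertex (bellaterra n) :=
  if n is n'.+1 then (b_end n', false) else tt.

Lemma b_end_loop n : joins Lb (b_end n) (b_end n).
Proof.
elim: n => [|n IHn]; first by exists Lb => //; left.
exact: (joins_lift true IHn).
Qed.

Lemma a_end_loop n : joins La (a_end n) (a_end n).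
Proof.
case: n => [|n]; first by exists La => //; left.
exact: (joins_lift false (b_end_loop n)).
Qed.

(** The end of the walk from [b_end n] obtained by lifting [n] times the walk of
[B_0] that reads [W], each time starting at the bit 1. *)
Fixpoint arrival n W : vertex (bellaterra n) :=
  if n is n'.+1
  then (arrival n' W, lift_end true (iter n' (lift_word true) W)) else tt.

Lemma reads_arrival n W :
  reads (iter n (lift_word true) W) (b_end n) (arrival n W).
Proof.
elim: n => [|n IHn]; last exact: (reads_lift true IHn).
by elim: W => //= l W IHW; exists tt => //; exists l => //; left.
Qed.

Lemma eq_arrival n W V :
  (forall j, j < n -> lift_end true (iter j (lift_word true) W) =
                      lift_end true (iter j (lift_word true) V)) ->
  arrival n W = arrival n V.
Proof.
elim: n => //= n IHn WV; rewrite WV// IHn// => j /ltnW; exact: WV.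
Qed.

(** Two words of length [n] that reach the same vertex [u] from [b_end n.-1], but
lift to walks from [b_end n] with different last bits.  Starting the second lift
at [a_end n] instead flips all its bits, so it ends where the first one does. *)
Lemma within_ends n : within n.*2 (b_end n) (a_end n).
Proof.
case: n => [|n]; first by exists [::].
have [W [sizeW perW xorW _]] := odometer n.+1.
pose s j := lift_end true (iter j (lift_word true) W).
have s_per t : s (t + 2 ^ n.+1) = s t by rewrite /s iterD perW.
have [i [k [ik_eq ik_neq]]] := exists_splitting_window (ltnSn n) s_per xorW.
have {}ik_eq : arrival n (iter i (lift_word true) W) =
               arrival n (iter k (lift_word true) W).
  apply: eq_arrival => j j_lt; rewrite -!iterD ![(j + _)%N]addnC; exact: ik_eq.
have size_iter j : size (iter j (lift_word true) W) = n.+1.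
  by elim: j => //= j; rewrite size_lift_word.
pose Wi := iter i (lift_word true) W; pose Wk := iter k (lift_word true) W.
have to_i := reads_arrival n.+1 Wi.
have to_k := reads_lift false (reads_arrival n Wk).
have endk : (arrival n Wk, lift_end false (iter n (lift_word true) Wk)) =
            arrival n.+1 Wi.
  rewrite /= -ik_eq -/Wi; congr (_, _).
  rewrite -[false]/(~~ true) lift_endN -!iterD ![(n + _)%N]addnC.
  by move: ik_neq; rewrite /s => ->.
rewrite endk in to_k.
rewrite -addnn; apply: (@within_trans _ _ _ _ (arrival n.+1 Wi)).
  by exists (iter n.+1 (lift_word true) Wi); rewrite // -iterD size_iter.
apply: withinC; exists (lift_word false (iter n (lift_word true) Wk)) => //.
by rewrite size_lift_word -iterD size_iter.
Qed.

(** The summand [n.*2.+1 = n.+1 ^ 2 - n ^ 2] pays for one crossing of the lifted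
a-loop and for the walk between the two ends. *)
Lemma within_a_end n (x : vertex (bellaterra n)) : within (n ^ 2) x (a_end n).
Proof.
elim: n x => [|n IHn] x; first by case: x; exists [::].
case: x => x i.
have [j to_end] := within_lift i (IHn x).
have [j' from_end] := within_lift false (within_ends n).
(* The edge (a_end n, 0) -- (a_end n, 1) is the lift of the a-loop. *)
  have swap : within (G := bellaterra n.+1) 1 (a_end n, j) (a_end n, j').
  have [<-|jj'] := eqVneq j j'; first by exists [::].
  have -> : j' = next_bit j La by case: j j' jj' {to_end from_end} => -[].
  exact: joins_within (joins_lift j (a_end_loop n)).
have -> : n.+1 ^ 2 = n ^ 2 + (1 + n.*2) by rewrite -addn1 sqrnD; lia.
apply: within_trans to_end _; apply: within_trans swap _.
exact: withinC from_end.
Qed.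

Lemma even_reads n (x y : vertex (bellaterra n)) :
  exists W, [/\ ~~ odd (size W), size W <= (n ^ 2).*2.+1 & reads W x y].
Proof.
have [W Wn xa] := within_a_end x; have [V Vn /reads_rev ay] := within_a_end y.
have [odd_|even_] := boolP (odd (size W + size V)).
  exists (W ++ La :: rev V); split.
  - by rewrite size_cat/= size_rev addnS/= odd_.
  - by rewrite size_cat/= size_rev -addnn; lia.
  - by apply: reads_cat xa _; exists (a_end n) => //; apply: a_end_loop.
exists (W ++ rev V); split; last exact: reads_cat ay.
  by rewrite size_cat size_rev.
by rewrite size_cat size_rev -addnn; lia.
Qed.

(** * From Bellaterra walks to Aleshin walks *)

Fixpoint flipped n (t : bool) : vertex (bellaterra n) -> vertex (aleshin n) :=
  if n is n'.+1 then fun x => (flipped t x.1, x.2 (+) t) else fun=> tt.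

Lemma flipped_surj n t (v : vertex (aleshin n)) : exists x, flipped t x = v.
Proof.
elim: n v => [|n IHn] v; first by case: v; exists tt.
case: v => v i; have [x xv] := IHn v.
by exists (x, i (+) t); rewrite /= xv addbK.
Qed.

Lemma joins_liftP (G : lgraph) l' (x y : vertex G) i j :
  joins (G := lift G) l' (x, i) (y, j) ->
  exists l, [/\ joins l x y, l' = lift_letter i l & j = next_bit i l].
Proof.
case=> -[e k] /= <- [[[<- <-] [<- <-]]|[[<- <-] [<- <-]]]; exists (lab e).
  by split=> //; exists e => //; left.
split; first by exists e => //; right.
  by case: k; case: (lab e).
by rewrite /next_bit; case: k; case: (lab e).
Qed.

(** The automata differ only by the flip of the new bit, and they write the same
label, which is what lets the induction go through. *)
Lemma aleshin_edge n l (x y : vertex (bellaterra n)) : joins l x y ->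
  exists e : edge (aleshin n),
    [/\ lab e = l, src e = flipped false x & tgt e = flipped true y].
Proof.
elim: n l x y => [|n IHn] l x y; first by exists l.
case: x y => x i [y j] /joins_liftP [l0 [xy -> ->]].
have [e [eE esrc etgt]] := IHn _ _ _ xy.
exists (e, i); rewrite /= eE esrc etgt addbF.
by split=> //; case: i; case: l0 {xy eE}.
Qed.

Lemma joins_adj (G : lgraph) l (x y : vertex G) : joins l x y -> adj x y.
Proof.
by case=> e _ [[<- <-]|[<- <-]]; apply/existsP; exists e; rewrite !eqxx ?orbT.
Qed.

Lemma adj_flipped n l (x y : vertex (bellaterra n)) t : joins l x y ->
  adj (flipped t x) (flipped (~~ t) y).
Proof.
move=> xy; case: t; last first.
  have [e [_ <- <-]] := aleshin_edge xy.
  by apply/existsP; exists e; rewrite !eqxx.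
have [e [_ <- <-]] := aleshin_edge (joinsC xy).
by apply/existsP; exists e; rewrite !eqxx orbT.
Qed.

Lemma path_length_reads (G : lgraph) W (x y : vertex G) :
  reads W x y -> path_lengths x y (size W).
Proof.
elim: W x => [x ->|l W IHW x [z xz /IHW [p [zp py pW]]]]; first by exists [::].
exists (z :: p); split=> //=; last by rewrite pW.
by rewrite zp andbT (joins_adj xz).
Qed.

(** Each step of an Aleshin walk flips all the bits once more, so only walks of
even length end at the vertex itself. *)
Lemma path_length_aleshin n W (x y : vertex (bellaterra n)) t :
  reads W x y ->
  path_lengths (flipped t x) (flipped (t (+) odd (size W)) y) (size W).
Proof.
elim: W x t => [x t ->|l W IHW x t [z xz zy]].
  by exists [::]; split; rewrite ?addbF.
have [p [zp py pW]] := IHW z (~~ t) zy.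
exists (flipped (~~ t) z :: p); split=> /=.
- by rewrite (adj_flipped t xz).
- by rewrite py addNb addbN.
- by rewrite pW.
Qed.

End LabeledWalks.

(** * Diameters *)

Section Diameter.
Variable R : realType.

Lemma diam_le (G : lgraph) N :
  (forall v w : vertex G, exists2 k, (k <= N)%N & path_lengths v w k) ->
  (diam R G <= N%:R%:E)%E.
Proof.
move=> short; apply: ge_ereal_sup => _ [[v w] _ <-] /=.
have [k kN vwk] := short v w.
apply: (@le_trans _ _ (k%:R%:E)%E); last by rewrite lee_fin ler_nat.
by apply: ereal_inf_lbound; exists k.
Qed.

Lemma diam_ge0 (G : lgraph) (v : vertex G) : (0 <= diam R G)%E.
Proof.
apply: (@le_trans _ _ (dist R v v)); last first.
  by apply: ereal_sup_ubound; exists (v, v).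
by apply: le_ereal_inf_tmp => _ [k _ <-]; rewrite lee_fin.
Qed.

Lemma quadratic_diam (G : nat -> lgraph) (v : forall n, vertex (G n)) :
  (forall n (x y : vertex (G n)),
     exists2 k, (k <= (n ^ 2).*2.+1)%N & path_lengths x y k) ->
  bigO_infty (fun n => diam R (G n)) (fun n => n%:R ^+ 2).
Proof.
move=> short; exists 3; near=> n.
rewrite gee0_abs; last exact: diam_ge0 (v n).
apply: le_trans (diam_le (short n)) _.
rewrite -natrX normr_nat -natrM lee_fin ler_nat.
have n_gt0 : (0 < n)%N by near: n; exact: nbhs_infty_gt.
have : (0 < n ^ 2)%N by rewrite expn_gt0 n_gt0.
by move: (n ^ 2)%N => N; lia.
Unshelve. all: by end_near.
Qed.

End Diameter.

Theorem theorem1p1 (R : realType) :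
  bigO_infty (fun n => diam R (aleshin n)) (fun n => n%:R ^+ 2) /\
  bigO_infty (fun n => diam R (bellaterra n)) (fun n => n%:R ^+ 2).
Proof.
split.
  apply: (@quadratic_diam _ aleshin (fun n => flipped false (b_end n))) => n v w.
  have [x <-] := flipped_surj false v; have [y <-] := flipped_surj false w.
  have [W [W_even Wn xy]] := even_reads x y.
  exists (size W) => //; have := path_length_aleshin false xy.
  by rewrite (negbTE W_even).
apply: (@quadratic_diam _ bellaterra b_end) => n x y.
have [W [_ Wn xy]] := even_reads x y.
by exists (size W) => //; apply: path_length_reads.
Qed.
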